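(* Let $\mathcal{A}=(A,\mathcal{R})$ be a $C$-algebra with unit $e$, and put $\mathcal{R}^\#=\mathcal{R}\setminus\{e\}$. Then $\mathcal{A}$ is homogeneous and amorphic if and only if $\mathrm{Aut}(\mathcal{A})\cong\mathrm{Sym}(\mathcal{R}^\#)$.
   Context: $C$-algebra: a pair $\mathcal{A}=(A,\mathcal{R})$ where $A$ is a finite-dimensional associative algebra over $\mathbb{C}$ with unit $e$ and a semilinear involutive anti-automorphism $*$, and $\mathcal{R}$ is a linear basis of $A$ with structure constants defined by $r\cdot s=\sum_{t\in\mathcal{R}}c_{r,s}^t t$ ($r,s\in\mathcal{R}$), such that: (C1) $e\in\mathcal{R}$ and $r^*\in\mathcal{R}$ for all $r\in\mathcal{R}$; (C2) $c_{r,s}^t\in\mathbb{R}$ for all $r,s,t\in\mathcal{R}$; (C3) for all $r,s\in\mathcal{R}$, $c_{r,s}^e=d_r\delta_{r^*,s}$ where $d_r>0$ and $\delta$ is the Kronecker symbol; (C4) the linear functional on $A$ defined by $r\mapsto d_r$ ($r\in\mathcal{R}$) is a one-dimensional $*$-representation of $A$. The $C$-algebra is homogeneous if $d_r$ does not depend on $r\in\mathcal{R}^\#$. $\mathrm{Aut}(\mathcal{A})$ is the group of all $*$-algebra automorphisms $\varphi$ of $A$ with $\varphi(\mathcal{R})=\mathcal{R}$; it acts faithfully on $\mathcal{R}$ fixing $e$, so it is naturally identified with a subgroup of $\mathrm{Sym}(\mathcal{R}^\#)$, the group of all permutations of $\mathcal{R}^\#$. Fusion: for a partition $\pi$ of $\mathcal{R}$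 with $\{e\}\in\pi$, the $\pi$-fusion of $\mathcal{A}$ is the pair $\mathcal{A}_\pi=(A_\pi,\mathcal{R}_\pi)$ where $\mathcal{R}_\pi=\{\sum_{r\in R}r:\ R\in\pi\}$ and $A_\pi$ is the linear span of $\mathcal{R}_\pi$; it is a $C$-algebra (with the inherited operations) iff $A_\pi$ is a $*$-subalgebra of $A$. Amorphic: $\mathcal{A}$ is amorphic if for every partition $\pi$ of $\mathcal{R}$ with $\{e\}\in\pi$ the $\pi$-fusion $\mathcal{A}_\pi$ is a $C$-algebra.
   Formalization: The implication from homogeneous and amorphic to Aut(A) ≅ Sym(R#) is proved only for |R| ≠ 3, since it fails for some C-algebras with |R| = 3; the converse is proved for all C-algebras. *)

(* Defs.v *)
From HB Require Import structures.
From mathcomp Require Import all_boot all_order all_algebra all_fingroup all_field.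
From mathcomp Require Import finmap boolp reals complex.

Set Implicit Arguments.
Unset Strict Implicit.
Unset Printing Implicit Defensive.

Import Order.TTheory GRing.Theory Num.Theory.
Local Open Scope ring_scope.

(* A C-algebra is a pair (V, B) made of an algebra and a distinguished basis.
   Here V is a subspace of an ambient finite-dimensional algebra A and carries
   the operations inherited from A, so that one predicate applies both to a
   pair (A, B), with V = fullv, and to its fusions. *)
Section CAlgebra.
Variables (C : numClosedFieldType) (A : falgType C) (star : A -> A).
Implicit Types (V : {vspace A}) (B : {fset A}).

(* The coefficient of t in the expansion of v in the basis B. *)
Definition bcoord B (v t : A) : C :=
  if insub (index t B) is Some i then coord (in_tuple B) i v else 0.

(* The structure constant written $c_{r,s}^t$. *)
Definition strc B (r s t : A) : C := bcoord B (r * s) t.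

Definition deg B (r : A) : C := strc B r (star r) 1.

Definition deg_functional B (v : A) : C := \sum_(t <- B) bcoord B v t * deg B t.

Record is_star_algebra V : Prop := IsStarAlgebra {
  star_alg1 : 1 \in V;
  star_algM : {in V &, forall u v, u * v \in V};
  star_alg_star : {in V, forall u, star u \in V};
  star_semilinear : forall a : C,
    {in V &, forall u v, star (a *: u + v) = a^* *: star u + star v};
  star_involutive : {in V, involutive star};
  star_antimorphism : {in V &, forall u v, star (u * v) = star v * star u} }.

Record is_calgebra V B : Prop := IsCAlgebra {
  calg_star_algebra : is_star_algebra V;
  calg_basis : basis_of V B;
  calg_one : 1 \in B;
  calg_star : {in B, forall r, star r \in B};
  calg_real : {in B & &, forall r s t, strc B r s t \is Num.real};
  calg_deg_gt0 : {in B, forall r, 0 < deg B r};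
  calg_strc1 :
    {in B &, forall r s, strc B r s 1 = deg B r * (star r == s)%:R};
  calg_deg1 : deg_functional B 1 = 1;
  calg_degM : {in V &, forall u v,
    deg_functional B (u * v) = deg_functional B u * deg_functional B v};
  calg_deg_star : {in V, forall u,
    deg_functional B (star u) = (deg_functional B u)^*} }.

Definition homogeneous B : Prop :=
  {in (B `\ 1)%fset &, forall r s, deg B r = deg B s}.

Definition fusion_basis B (pi : {set {set B}}) : {fset A} :=
  [fset \sum_(r in (P : {set B})) val r | P in pi]%fset.

Definition fusion_space B (pi : {set {set B}}) : {vspace A} :=
  <<fusion_basis pi>>%VS.

(* [set r | val r == 1] is the singleton {e} as soon as e = 1 belongs to B. *)
Definition amorphic B : Prop :=
  forall pi : {set {set B}},
    partition pi [set: B] -> [set r : B | val r == 1] \in pi ->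
    is_calgebra (fusion_space pi) (fusion_basis pi).

Record is_calg_aut B (f : 'End(A)) : Prop := IsCAlgAut {
  calg_aut_bij : bijective f;
  calg_aut1 : f 1 = 1;
  calg_autM : {morph f : u v / u * v};
  calg_aut_star : {morph f : u / star u};
  calg_aut_basis : [fset f r | r in B]%fset = B }.

Definition calg_aut B := {f : 'End(A) | `[< is_calg_aut B f >]}.

HB.instance Definition _ B := SubChoice.on (calg_aut B).

Section AutGroup.
Variable B : {fset A}.

Fact calg_aut_id : `[< is_calg_aut B \1%VF >].
Proof.
apply/asboolP; split=> [||u v|u|]; rewrite ?id_lfunE //.
  by exists id => u; rewrite id_lfunE.
by apply/fsetP=> u; apply/imfsetP/idP=> [[r rB ->]|uB];
  [rewrite id_lfunE | exists u; rewrite ?id_lfunE].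
Qed.

Fact calg_aut_comp (f g : calg_aut B) :
  `[< is_calg_aut B (val f \o val g)%VF >].
Proof.
case: f g => [f /asboolP[fb f1 fM fs fB]] [g /asboolP[gb g1 gM gs gB]] /=.
apply/asboolP; split=> [||u v|u|]; rewrite ?comp_lfunE ?g1 ?gM ?gs //=.
  by apply: (eq_bij (bij_comp fb gb)) => u; rewrite comp_lfunE.
apply/fsetP=> u; rewrite -[in RHS]fB; apply/imfsetP/imfsetP => /= -[r rB ->].
  by exists (g r); rewrite ?comp_lfunE // -gB; apply/imfsetP; exists r.
move: rB; rewrite -[X in _ \in X]gB => /imfsetP[s /= sB ->].
by exists s; rewrite ?comp_lfunE.
Qed.

Fact calg_aut_lfunVK (f : calg_aut B) :
  cancel (val f) (val f)^-1%VF /\ cancel (val f)^-1%VF (val f).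
Proof.
case: f => [f /asboolP[fb _ _ _ _]] /=.
have fK : cancel f f^-1%VF by apply/lker0_lfunK/lker0P/bij_inj.
by split=> //; apply/(bij_can_sym fb).
Qed.

Fact calg_aut_inv (f : calg_aut B) : `[< is_calg_aut B (val f)^-1%VF >].
Proof.
have [] := calg_aut_lfunVK f.
case: f => [f /asboolP[fb f1 fM fs fB]] /= fK Kf.
apply/asboolP; split=> [||u v|u|].
- by exists f.
- by rewrite -[in LHS]f1 fK.
- by rewrite -[in LHS](Kf u) -[in LHS](Kf v) -fM fK.
- by rewrite -[in LHS](Kf u) -fs fK.
apply/fsetP=> u; apply/imfsetP/idP => /= [[r + ->]|uB].
  by rewrite -[X in _ \in X -> _]fB => /imfsetP[s /= sB ->]; rewrite fK.
by exists (f u); rewrite ?fK // -fB; apply/imfsetP; exists u.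
Qed.

Definition calg_aut_one : calg_aut B := exist _ \1%VF calg_aut_id.
Definition calg_aut_mul (f g : calg_aut B) : calg_aut B :=
  exist _ (val f \o val g)%VF (calg_aut_comp f g).
Definition calg_aut_invf (f : calg_aut B) : calg_aut B :=
  exist _ (val f)^-1%VF (calg_aut_inv f).

Fact calg_aut_mulA : associative calg_aut_mul.
Proof. by move=> f g h; apply: val_inj; rewrite /= comp_lfunA. Qed.

Fact calg_aut_mul1 : left_id calg_aut_one calg_aut_mul.
Proof. by move=> f; apply: val_inj; rewrite /= comp_lfun1l. Qed.

Fact calg_aut_mulr1 : right_id calg_aut_one calg_aut_mul.
Proof. by move=> f; apply: val_inj; rewrite /= comp_lfun1r. Qed.

Fact calg_aut_mulV : left_inverse calg_aut_one calg_aut_invf calg_aut_mul.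
Proof.
move=> f; apply/val_inj/lfunP => u /=; rewrite comp_lfunE id_lfunE.
by case: (calg_aut_lfunVK f).
Qed.

Fact calg_aut_mulrV : right_inverse calg_aut_one calg_aut_invf calg_aut_mul.
Proof.
move=> f; apply/val_inj/lfunP => u /=; rewrite comp_lfunE id_lfunE.
by case: (calg_aut_lfunVK f).
Qed.

End AutGroup.

HB.instance Definition _ B := isGroup.Build (calg_aut B)
  (@calg_aut_mulA B) (@calg_aut_mul1 B) (@calg_aut_mulr1 B)
  (@calg_aut_mulV B) (@calg_aut_mulrV B).

End CAlgebra.

Definition group_iso (G H : groupType) : Prop :=
  exists f : {multiplicative G -> H}, bijective f.

(* Main.v *)
From HB Require Import structures.
Require Import Defs.
From mathcomp Require Import all_boot all_order all_algebra all_fingroup all_field.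
From mathcomp Require Import finmap boolp reals complex.

Local Open Scope ring_scope.

Set Implicit Arguments.
Unset Strict Implicit.
Unset Printing Implicit Defensive.

Import Order.TTheory GRing.Theory Num.Theory.

(** Write I for the set of basis elements other than the unit. An automorphism
is determined by the permutation of I that it induces, so the automorphism
group embeds in the group of permutations of I. As that group is finite, an
abstract isomorphism between the two exists exactly when every permutation of
I is induced by an automorphism ([group_iso_realizable]), and it is this last
property that has to be compared with being homogeneous and amorphic.

Suppose that every permutation of I is induced. A transposition of two
elements of I shows that they have the same degree. For amorphicity, take a
partition with the unit alone in its block. A vector lies in the fusion space
exactly when its coordinates are constant on the blocks
([mem_fusion_space]), so a transposition inside a block induces an
automorphism that fixes the fusion space pointwise, and these automorphisms
together fix nothing else. The fusion space, being the fixed space of a family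
of automorphisms, is closed under product and star, and this is all that is
needed for the fusion to be a C-algebra ([fusion_calgebra]).

Conversely suppose that the algebra is homogeneous of degree k and amorphic,
and that I has at least three elements; two elements mean rank 3, and with at
most one element there is only the identity permutation. Fusing all the
elements of I outside {r, s} into one block shows that the coefficients
c_{rs}^t agree for all t outside {1, r, s}, and, as fused algebras are closed
under star, that star fixes the basis ([amorphic_star_basis]). So the algebra
is commutative, and for r, s, t in I the coefficient of the unit in (r s) t is
k c_{rs}^t; hence c_{rs}^t is symmetric in r, s, t. The degree map gives for
each pair r, s of elements of I that the sum of c_{rs}^t over t in I is
k - [r = s]. These properties make c invariant under all permutations of I
([tensor_perm]): the entries with distinct indices are all equal; the sums for
r <> s then give that c_{rr}^s + c_{ss}^r is invariant for each pair, and
three points force each term to be; the sums for r = s give the invariance of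
c_{rr}^r. So every permutation of I preserves the structure constants and
extends linearly to an automorphism ([perm_fun_aut]). *)

(** * Coordinates in a basis *)

Section Coordinates.
Variables (C : numClosedFieldType) (A : falgType C).
Implicit Types B : {fset A}.

Lemma bcoordZD B a u v t :
  bcoord B (a *: u + v) t = a * bcoord B u t + bcoord B v t.
Proof.
rewrite /bcoord; case: insub => [i|]; last by rewrite mulr0 addr0.
exact: linearP.
Qed.

Lemma bcoordZ B a u t : bcoord B (a *: u) t = a * bcoord B u t.
Proof. by rewrite /bcoord; case: insub => [i|]; rewrite ?mulr0 ?linearZ. Qed.

Lemma bcoordD B u v t : bcoord B (u + v) t = bcoord B u t + bcoord B v t.
Proof. by rewrite -[u]scale1r bcoordZD mul1r scale1r. Qed.

Lemma bcoord0 B t : bcoord B 0 t = 0.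
Proof. by rewrite -[0 in LHS](scale0r 0) bcoordZ mul0r. Qed.

Lemma bcoord_sum B (I : Type) (s : seq I) (P : pred I) (F : I -> A) t :
  bcoord B (\sum_(i <- s | P i) F i) t = \sum_(i <- s | P i) bcoord B (F i) t.
Proof.
apply: (big_morph (fun v => bcoord B v t)); last exact: bcoord0.
by move=> u v; apply: bcoordD.
Qed.

Lemma bcoord_basis B s t : free B -> s \in B -> t \in B ->
  bcoord B s t = (s == t)%:R.
Proof.
move=> Bfree sB tB; rewrite /bcoord.
case: insubP => [i _ idx_t|/negP[]]; last by rewrite index_mem.
have lt_s : (index s B < size B)%N by rewrite index_mem.
rewrite -[s in coord _ _ s](nth_index 0 sB).
rewrite -[index s B]/(val (Ordinal lt_s)) coord_free //.
rewrite -val_eqE /= idx_t; congr (nat_of_bool _)%:R.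
apply/eqP/eqP => [eq_i|->] //.
by rewrite -(nth_index 0 sB) -(nth_index 0 tB) eq_i.
Qed.

Lemma bcoord_span B v : v \in <<B>>%VS -> v = \sum_(t <- B) bcoord B v t *: t.
Proof.
move=> /(coord_span (X := in_tuple B)) {1}->.
rewrite (big_nth 0) big_mkord; apply: eq_bigr => i _; congr (_ *: _).
rewrite /bcoord index_uniq ?fset_uniq //.
case: insubP => [j _ eq_ji|/negP[]]; last exact: ltn_ord.
by congr (coord _ _ _); apply: val_inj.
Qed.

Lemma bcoord_inj B u v : u \in <<B>>%VS -> v \in <<B>>%VS ->
  {in B, bcoord B u =1 bcoord B v} -> u = v.
Proof.
move=> uB vB eq_uv; rewrite (bcoord_span uB) (bcoord_span vB).
by apply: eq_big_seq => t tB; rewrite eq_uv.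
Qed.

End Coordinates.

(** * Fusions of a C-algebra *)

Section Fusion.
Variables (C : numClosedFieldType) (A : falgType C) (star : A -> A).
Variables (B : {fset A}) (hB : is_calgebra star fullv B).

Lemma calg_free : free B.
Proof. exact: basis_free (calg_basis hB). Qed.

Lemma calg_span v : v \in <<B>>%VS.
Proof. by rewrite (span_basis (calg_basis hB)) memvf. Qed.

Lemma calg_expand v : v = \sum_(t : B) bcoord B v (val t) *: val t.
Proof. by rewrite {1}(bcoord_span (calg_span v)) big_seq_fsetE. Qed.

Lemma calg_ext u v :
  (forall t : B, bcoord B u (val t) = bcoord B v (val t)) -> u = v.
Proof.
move=> eq_uv; apply: (bcoord_inj (calg_span u) (calg_span v)) => t tB.
exact: (eq_uv [` tB]%fset).
Qed.

Lemma bcoord_val (s t : B) : bcoord B (val s) (val t) = (s == t)%:R.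
Proof. by rewrite (bcoord_basis calg_free (valP s) (valP t)). Qed.

Lemma starP a u v : star (a *: u + v) = a^* *: star u + star v.
Proof. by rewrite (star_semilinear (calg_star_algebra hB)) ?memvf. Qed.

Lemma starK : involutive star.
Proof.
by move=> u; apply: (star_involutive (calg_star_algebra hB)); rewrite memvf.
Qed.

Lemma starM u v : star (u * v) = star v * star u.
Proof. by rewrite (star_antimorphism (calg_star_algebra hB)) ?memvf. Qed.

Lemma starD u v : star (u + v) = star u + star v.
Proof. by rewrite -[u]scale1r starP conjC1 !scale1r. Qed.

Lemma star0 : star 0 = 0.
Proof. by apply: (@addrI _ (star 0)); rewrite -starD !addr0. Qed.

Lemma starZ a u : star (a *: u) = a^* *: star u.
Proof. by rewrite -[a *: u]addr0 starP star0 addr0. Qed.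

Lemma star1 : star 1 = 1.
Proof. by rewrite -[LHS]mulr1 -[X in _ * X]starK -starM mulr1 starK. Qed.

Lemma star_sum (I : Type) (s : seq I) (P : pred I) (F : I -> A) :
  star (\sum_(i <- s | P i) F i) = \sum_(i <- s | P i) star (F i).
Proof. exact: (big_morph star starD star0). Qed.

Definition starB (x : B) : B := [` calg_star hB (valP x)]%fset.
Definition unitB : B := [` calg_one hB]%fset.

Lemma starBK : involutive starB.
Proof. by move=> x; apply: val_inj; rewrite /= starK. Qed.

Definition block_sum (P : {set B}) : A := \sum_(r in P) val r.

Lemma bcoord_block_sum P (t : B) :
  bcoord B (block_sum P) (val t) = (t \in P)%:R.
Proof.
rewrite bcoord_sum; under eq_bigr => r _ do rewrite bcoord_val.
have [tP|tNP] := boolP (t \in P).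
  rewrite (bigD1 t) //= eqxx big1 ?addr0 // => r /andP[_ /negPf->] //.
rewrite big1 // => r rP; case: eqP rP => // ->.
by rewrite (negPf tNP).
Qed.

Lemma block_sum_inj : injective block_sum.
Proof.
move=> P Q eqPQ; apply/setP => t; apply/idP/idP => tin.
all: have := bcoord_block_sum P t; rewrite eqPQ bcoord_block_sum tin.
all: by case: (t \in _) => // /eqP; rewrite ?oner_eq0 // eq_sym oner_eq0.
Qed.

Lemma block_sum1 : block_sum [set unitB] = 1.
Proof. by rewrite /block_sum big_set1. Qed.

Lemma star_block_sum P : star (block_sum P) = block_sum (starB @: P).
Proof.
rewrite star_sum [RHS]big_imset //=.
by move=> x y _ _; apply: (can_inj starBK).
Qed.

Section Partition.
Variable (pi : {set {set B}}).
Hypothesis pi_part : partition pi [set: B].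

Lemma block_eq (P Q : {set B}) x :
  P \in pi -> Q \in pi -> x \in P -> x \in Q -> P = Q.
Proof.
case/and3P: pi_part => _ /trivIsetP tI _ Ppi Qpi xP xQ.
apply/eqP/negPn/negP => /(tI _ _ Ppi Qpi) /pred0P/(_ x) /=.
by rewrite xP xQ.
Qed.

Lemma block_nonempty (P : {set B}) : P \in pi -> exists x, x \in P.
Proof.
case/and3P: pi_part => _ _ set0pi Ppi; apply/set0Pn.
by apply: contraNneq set0pi => <-.
Qed.

Lemma block_exists x : exists2 P : {set B}, P \in pi & x \in P.
Proof.
have /and3P[/eqP cov _ _] := pi_part.
have : x \in cover pi by rewrite cov inE.
by case/bigcupP => P; exists P.
Qed.

Lemma fusion_basisP x :
  reflect (exists2 P : {set B}, P \in pi & x = block_sum P)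
          (x \in fusion_basis pi).
Proof. by apply: (iffP (imfsetP _ _ _ _)) => -[P Ppi ->]; exists P. Qed.

(** Evaluating a coordinate at any chosen point of a block separates the block
sums: this is what makes them linearly independent, and what identifies their
dual basis. *)
Lemma bcoord_block (P Q : {set B}) r : P \in pi -> Q \in pi -> r \in P ->
  bcoord B (block_sum Q) (val r) = (block_sum Q == block_sum P)%:R.
Proof.
move=> Ppi Qpi rP; rewrite bcoord_block_sum (inj_eq block_sum_inj).
have [rQ|rNQ] := boolP (r \in Q).
  by rewrite (block_eq Ppi Qpi rP rQ) eqxx.
by case: eqP rNQ => // ->; rewrite rP.
Qed.

Lemma fusion_free : free (fusion_basis pi).
Proof.
rewrite -[fusion_basis pi : seq _]in_tupleE; apply/freeP => k sum0 i.
have /fusion_basisP[P Ppi defi] := mem_nth 0 (ltn_ord i).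
have [r rP] := block_nonempty Ppi.
have := congr1 (fun v => bcoord B v (val r)) sum0.
rewrite bcoord_sum bcoord0 (bigD1 i) //= big1 ?addr0.
  by rewrite bcoordZ defi (bcoord_block Ppi) // eqxx mulr1.
move=> j ji; have /fusion_basisP[Q Qpi defj] := mem_nth 0 (ltn_ord j).
rewrite bcoordZ defj (bcoord_block Ppi) // -defi -defj nth_uniq ?fset_uniq //.
by rewrite val_eqE (negPf ji) mulr0.
Qed.

Lemma fusion_bcoord v (P : {set B}) r :
    v \in fusion_space pi -> P \in pi -> r \in P ->
  bcoord (fusion_basis pi) v (block_sum P) = bcoord B v (val r).
Proof.
move=> vV Ppi rP; rewrite {2}(bcoord_span vV) bcoord_sum.
have PF : block_sum P \in fusion_basis pi by apply/fusion_basisP; exists P.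
rewrite (big_fsetD1 _ PF) /= bcoordZ (bcoord_block Ppi) // eqxx mulr1.
rewrite big_seq_cond big1 ?addr0 // => x; rewrite andbT in_fsetD1.
case/andP=> xP /fusion_basisP[Q Qpi defx].
by rewrite bcoordZ defx (bcoord_block Ppi) // -defx (negPf xP) mulr0.
Qed.

(** The coordinates of a block sum are the indicator function of the block, so
the span consists of the vectors with constant coordinates on blocks. *)
Lemma mem_fusion_space v : v \in fusion_space pi <->
  {in pi, forall P : {set B},
    {in P &, forall x y, bcoord B v (val x) = bcoord B v (val y)}}.
Proof.
split=> [vV P Ppi x y xP yP|v_const].
  by rewrite -!(fusion_bcoord vV Ppi).
rewrite [v]calg_expand.
under eq_bigl => t do rewrite -(in_setT t).
rewrite (set_partition_big _ pi_part) /=; apply: memv_suml => P Ppi.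
have [x xP] := block_nonempty Ppi.
rewrite (_ : \sum_(t in P) _ = bcoord B v (val x) *: block_sum P).
  by apply/memvZ/memv_span/fusion_basisP; exists P.
by rewrite scaler_sumr; apply: eq_bigr => t tP; rewrite (v_const P Ppi t x).
Qed.

Lemma block_sum_mem (P : {set B}) : P \in pi -> block_sum P \in fusion_space pi.
Proof. by move=> Ppi; apply/memv_span/fusion_basisP; exists P. Qed.

Hypothesis pi1 : [set r : B | val r == 1] \in pi.
Hypothesis piM : {in fusion_space pi &, forall u v, u * v \in fusion_space pi}.
Hypothesis piS : {in fusion_space pi, forall u, star u \in fusion_space pi}.

Local Notation F := (fusion_basis pi).

Lemma unit_block : [set unitB] \in pi.
Proof.
rewrite (_ : [set unitB] = [set r : B | val r == 1]) //.
by apply/setP => r; rewrite !inE -val_eqE.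
Qed.

Lemma fusion_mem1 : 1 \in fusion_space pi.
Proof. by rewrite -block_sum1; apply/block_sum_mem/unit_block. Qed.

Lemma fusion_bcoord1 v : v \in fusion_space pi -> bcoord F v 1 = bcoord B v 1.
Proof.
move=> vV; rewrite -[in LHS]block_sum1.
by rewrite (fusion_bcoord (r := unitB) vV unit_block) ?inE.
Qed.

(** The image of a block P under star has its sum in the fusion space, so it is
a union of blocks; it contains a single one, Q, because the image of Q under
star is in the same way a union of blocks, and one of them is P. *)
Lemma star_block (P : {set B}) : P \in pi -> starB @: P \in pi.
Proof.
have stP (Q Q' : {set B}) x : Q \in pi -> Q' \in pi -> x \in Q ->
    starB x \in Q' -> Q' \subset starB @: Q.
  move=> Qpi Q'pi xQ xQ'; apply/subsetP => y yQ'.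
  have /mem_fusion_space/(_ Q' Q'pi _ _ xQ' yQ') := piS (block_sum_mem Qpi).
  rewrite star_block_sum !bcoord_block_sum imset_f //.
  by case: (y \in _) => // /eqP; rewrite oner_eq0.
move=> Ppi; have [r rP] := block_nonempty Ppi.
have [Q Qpi rQ] := block_exists (starB r).
suff -> : starB @: P = Q by [].
apply/eqP; rewrite eqEsubset (stP P Q r) // andbT.
have /subsetP sPQ : P \subset starB @: Q.
  by apply: (stP Q P (starB r)); rewrite ?starBK.
apply/subsetP => _ /imsetP[x /sPQ /imsetP[y yQ ->] ->].
by rewrite starBK.
Qed.

Lemma bcoord_mul_block_sum (P Q : {set B}) t :
  bcoord B (block_sum P * block_sum Q) t =
  \sum_(r in P) \sum_(s in Q) strc B (val r) (val s) t.
Proof.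
rewrite mulr_suml bcoord_sum; apply: eq_bigr => r _.
by rewrite mulr_sumr bcoord_sum.
Qed.

Lemma block_strc1 (P Q : {set B}) : P \in pi -> Q \in pi ->
  bcoord B (block_sum P * block_sum Q) 1 =
  (\sum_(r in P) deg star B (val r)) * (starB @: P == Q)%:R.
Proof.
move=> Ppi Qpi; rewrite bcoord_mul_block_sum mulr_suml; apply: eq_bigr => r rP.
under eq_bigr => s sQ do rewrite (calg_strc1 hB (valP r) (valP s)).
rewrite -mulr_sumr; congr (_ * _).
have srP : starB r \in starB @: P by rewrite imset_f.
have [<-|neq] := eqVneq (starB @: P) Q.
  rewrite (bigD1 (starB r)) //= eqxx big1 ?addr0 // => s /andP[_].
  by rewrite -val_eqE /= eq_sym => /negPf->.
rewrite big1 // => s sQ; case: eqP => // def_s; case/eqP: neq.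
apply: (block_eq (x := starB r)) => //; first exact: star_block.
by rewrite (_ : starB r = s) //; apply: val_inj.
Qed.

Lemma fusion_deg (P : {set B}) : P \in pi ->
  deg star F (block_sum P) = \sum_(r in P) deg star B (val r).
Proof.
move=> Ppi; rewrite /deg /strc fusion_bcoord1 ?piM ?piS ?block_sum_mem //.
by rewrite star_block_sum block_strc1 ?star_block // eqxx mulr1.
Qed.

Lemma fusion_deg_functional v : v \in fusion_space pi ->
  deg_functional star F v = deg_functional star B v.
Proof.
move=> vV; rewrite /deg_functional [RHS]big_seq_fsetE /=.
under [RHS]eq_bigl => t do rewrite -(in_setT t).
rewrite (set_partition_big _ pi_part) /= big_imfset /=; last first.
  by move=> P Q _ _; apply: block_sum_inj.
rewrite big_enum /=; apply: eq_bigr => P Ppi; rewrite -/(block_sum P).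
rewrite fusion_deg // mulr_sumr; apply: eq_bigr => r rP.
by rewrite -(fusion_bcoord vV Ppi rP).
Qed.

(** Only the closure of the fusion space under product and star has to be
assumed: coordinates, coefficients of the unit and degrees in the fusion are
read off from those of the whole algebra. *)
Theorem fusion_calgebra : is_calgebra star (fusion_space pi) F.
Proof.
have inV r : r \in F -> r \in fusion_space pi by exact: memv_span.
split.
- split=> //; first exact: fusion_mem1.
  + by move=> a u v _ _; apply: starP.
  + by move=> u _; apply: starK.
  + by move=> u v _ _; apply: starM.
- by rewrite /basis_of eqxx fusion_free.
- by apply/fusion_basisP; exists [set unitB]; rewrite ?block_sum1 ?unit_block.
- move=> _ /fusion_basisP[P Ppi ->]; rewrite star_block_sum.
  by apply/fusion_basisP; exists (starB @: P); rewrite ?star_block.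
- move=> u v w /fusion_basisP[P Ppi ->] /fusion_basisP[Q Qpi ->].
  move=> /fusion_basisP[T Tpi ->]; have [t tT] := block_nonempty Tpi.
  rewrite /strc (fusion_bcoord _ Tpi tT) ?piM ?block_sum_mem //.
  rewrite bcoord_mul_block_sum.
  apply: rpred_sum => r _; apply: rpred_sum => s _.
  by apply: (calg_real hB); apply: valP.
- move=> _ /fusion_basisP[P Ppi ->]; rewrite fusion_deg //.
  have [r rP] := block_nonempty Ppi.
  rewrite (bigD1 r) //= ltr_wpDr ?(calg_deg_gt0 hB (valP r)) //.
  by apply: sumr_ge0 => s _; rewrite ltW // (calg_deg_gt0 hB (valP s)).
- move=> u v /fusion_basisP[P Ppi ->] /fusion_basisP[Q Qpi ->].
  rewrite /strc fusion_bcoord1 ?piM ?block_sum_mem // block_strc1 //.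
  by rewrite fusion_deg // star_block_sum (inj_eq block_sum_inj).
- by rewrite fusion_deg_functional ?fusion_mem1 // (calg_deg1 hB).
- move=> u v uV vV; rewrite !fusion_deg_functional ?piM //.
  by rewrite (calg_degM hB) ?memvf.
move=> u uV; rewrite !fusion_deg_functional ?piS //.
by rewrite (calg_deg_star hB) ?memvf.
Qed.

End Partition.
End Fusion.

(** * Permutation invariance of symmetric tensors *)

Section SymmetricTensor.
Variables (F : numDomainType) (T : finType) (c : T -> T -> T -> F) (k : F).
Hypothesis cardT : (2 < #|T|)%N.
Hypothesis cC : forall x y z, c x y z = c y x z.
Hypothesis cR : forall x y z, c x y z = c y z x.
Hypothesis c_const : forall x y z t, z != x -> z != y -> t != x -> t != y ->
  c x y z = c x y t.
Hypothesis c_sum : forall x y, \sum_z c x y z = k - (x == y)%:R.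

Lemma tensor_swap23 x y z : c x y z = c x z y.
Proof. by rewrite cR cC -cR. Qed.

Lemma third_point x y : exists2 z : T, z != x & z != y.
Proof.
have /subsetPn[z _] : ~~ ([set: T] \subset [set x; y]).
  apply/negP => /subset_leq_card; rewrite cardsT leqNgt.
  by rewrite (leq_trans _ cardT) // ltnS cards2; case: (_ == _).
by rewrite !inE negb_or => /andP[]; exists z.
Qed.

(** If the second indices differ, the third ones can be changed to y' and to y,
and c x y y' = c x y' y by symmetry. *)
Lemma tensor_distinct_same x y z y' z' :
    x != y -> x != z -> y != z -> x != y' -> x != z' -> y' != z' ->
  c x y z = c x y' z'.
Proof.
move=> xy xz yz xy' xz' yz'; have [eq_y|ny] := eqVneq y y'.
  by rewrite -eq_y in yz' *; apply: c_const; rewrite // eq_sym.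
rewrite (@c_const x y z y') 1?eq_sym // tensor_swap23.
by apply: c_const; rewrite // eq_sym.
Qed.

Lemma tensor_distinct x y z x' y' z' :
    x != y -> x != z -> y != z -> x' != y' -> x' != z' -> y' != z' ->
  c x y z = c x' y' z'.
Proof.
move=> xy xz yz xy' xz' yz'; have [eq_x|nx] := eqVneq x x'.
  by rewrite -eq_x in xy' xz' *; apply: tensor_distinct_same.
have [w wx wx'] := third_point x x'.
transitivity (c x x' w).
  by apply: tensor_distinct_same; rewrite // eq_sym.
by rewrite cC; apply: tensor_distinct_same; rewrite // eq_sym.
Qed.

Variable s : {perm T}.

Lemma tensor_perm_pair x y z : x != y -> z != x -> z != y ->
  c (s x) (s y) (s z) = c x y z.
Proof.
move=> xy zx zy.
by apply: tensor_distinct; rewrite ?(inj_eq perm_inj) // eq_sym.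
Qed.

(** In the sums of the rows (s x, s y) and (x, y), which agree, the terms with
three distinct indices cancel. *)
Lemma tensor_perm_sum x y : x != y ->
  c (s x) (s x) (s y) + c (s y) (s y) (s x) = c x x y + c y y x.
Proof.
move=> xy.
have yx : y != x by rewrite eq_sym.
have := c_sum (s x) (s y).
rewrite (inj_eq perm_inj) -c_sum (reindex_inj (@perm_inj _ s)) /=.
rewrite (bigD1 x) //= (bigD1 y) //= [RHS](bigD1 x) //=.
rewrite [X in _ = _ + X](bigD1 y) //= !addrA.
rewrite (eq_bigr (fun z => c x y z)) => [/addIr|z /andP[zx zy]]; last first.
  exact: tensor_perm_pair.
have diag u v : c u v u + c u v v = c u u v + c v v u.
  by rewrite tensor_swap23 [c u v v]cR.
by rewrite !diag.
Qed.

(** The defect d of invariance depends only on its first index, and by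
[tensor_perm_sum] the defects at two distinct points are opposite. Applied to
the three pairs among three points, this makes d equal to its own opposite. *)
Lemma tensor_perm_diag2 x y : x != y -> c (s x) (s x) (s y) = c x x y.
Proof.
move=> xy; have [z zx zy] := third_point x y.
have yx : y != x by rewrite eq_sym.
pose d u v := c (s u) (s u) (s v) - c u u v.
have d_const u v w : v != u -> w != u -> d u v = d u w.
  move=> vu wu; rewrite /d (@c_const u u v w) //.
  by rewrite (@c_const (s u) (s u) (s v) (s w)) ?(inj_eq perm_inj).
have d_opp u v : u != v -> d u v = - d v u.
  move=> uv; apply/eqP; rewrite -addr_eq0 /d addrACA -opprD.
  by rewrite tensor_perm_sum // subrr.
have : d x y = - d x y.
  rewrite {1}(d_const x y z) // d_opp 1?eq_sym // (d_const z x y) 1?eq_sym //.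
  by rewrite d_opp // (d_const y z x) // -d_opp.
by move/eqP; rewrite -addr_eq0 -mulr2n mulrn_eq0 /= subr_eq0 => /eqP.
Qed.

Lemma tensor_perm_diag x : c (s x) (s x) (s x) = c x x x.
Proof.
have := c_sum (s x) (s x); rewrite (inj_eq perm_inj) -c_sum.
rewrite (reindex_inj (@perm_inj _ s)) /= (bigD1 x) //= [RHS](bigD1 x) //=.
rewrite (eq_bigr (fun z => c x x z)) => [/addIr //|z zx].
by rewrite tensor_perm_diag2 // eq_sym.
Qed.

Lemma tensor_perm x y z : c (s x) (s y) (s z) = c x y z.
Proof.
have [<-|xy] := eqVneq x y.
  have [<-|xz] := eqVneq x z; first exact: tensor_perm_diag.
  exact: tensor_perm_diag2.
have [->|zx] := eqVneq z x.
  by rewrite tensor_swap23 tensor_perm_diag2 // [RHS]tensor_swap23.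
have [->|zy] := eqVneq z y; last exact: tensor_perm_pair.
by rewrite [LHS]cR tensor_perm_diag2 1?eq_sym // [RHS]cR.
Qed.

End SymmetricTensor.

(** * Automorphisms and permutations of the basis *)

Section Automorphisms.
Variables (C : numClosedFieldType) (A : falgType C) (star : A -> A).
Variables (B : {fset A}) (hB : is_calgebra star fullv B).
Local Notation I := (B `\ 1)%fset.
Local Notation e := (unitB hB).
Local Notation starB := (starB hB).

Definition of_nonunit (x : I) : B :=
  [` fsubsetP (fsubsetDl B [fset 1]%fset) _ (valP x)]%fset.

Lemma of_nonunit_inj : injective of_nonunit.
Proof. by move=> x y /(congr1 val) /= /val_inj. Qed.

Lemma of_nonunit_neq1 x : of_nonunit x != e.
Proof.
by rewrite -val_eqE /=; have := valP x; rewrite in_fsetD1 => /andP[].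
Qed.

Variant basis_spec : B -> Type :=
  | BasisUnit : basis_spec e
  | BasisNonunit x : basis_spec (of_nonunit x).

Lemma basisP x : basis_spec x.
Proof.
have [->|xe] := eqVneq x e; first by left.
have xI : val x \in I by rewrite in_fsetD1 (valP x) andbT.
by rewrite (_ : x = of_nonunit [` xI]%fset); [right | apply: val_inj].
Qed.

Section Automorphism.
Variable f : 'End(A).
Hypothesis hf : is_calg_aut star B f.

Lemma calg_aut_mem r : r \in B -> f r \in B.
Proof.
move=> rB; rewrite -[X in _ \in X](calg_aut_basis hf).
by apply/imfsetP; exists r.
Qed.

Lemma calg_aut_inj : injective f.
Proof. exact: bij_inj (calg_aut_bij hf). Qed.

Lemma calg_aut_bcoord v t : t \in B -> bcoord B (f v) (f t) = bcoord B v t.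
Proof.
move=> tB; rewrite {1}(bcoord_span (calg_span hB v)) linear_sum bcoord_sum.
have fB := calg_free hB.
have ftB := calg_aut_mem tB.
rewrite (big_fsetD1 _ tB) /= linearZ bcoordZ (bcoord_basis fB ftB ftB).
rewrite eqxx mulr1.
rewrite big_seq_cond big1 ?addr0 // => s; rewrite andbT in_fsetD1.
case/andP=> st sB; rewrite linearZ bcoordZ.
rewrite (bcoord_basis fB (calg_aut_mem sB) ftB).
by rewrite (inj_eq calg_aut_inj) (negPf st) mulr0.
Qed.

Lemma calg_aut_deg r : r \in B -> deg star B (f r) = deg star B r.
Proof.
move=> rB; rewrite /deg /strc -(calg_aut_star hf) -(calg_autM hf).
by rewrite -[X in bcoord _ _ X](calg_aut1 hf) calg_aut_bcoord ?(calg_one hB).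
Qed.

Lemma calg_aut_mem_nonunit (x : I) : f (val x) \in I.
Proof.
have := valP x; rewrite !in_fsetD1 => /andP[x1 xB].
rewrite calg_aut_mem // andbT.
apply: contraNneq x1 => fx1.
by apply/eqP/calg_aut_inj; rewrite fx1 (calg_aut1 hf).
Qed.

Definition nonunit_map (x : I) : I := [` calg_aut_mem_nonunit x]%fset.

Lemma nonunit_map_inj : injective nonunit_map.
Proof. by move=> x y /(congr1 val) /= /calg_aut_inj/val_inj. Qed.

End Automorphism.

Definition nonunit_perm (f : calg_aut star B) : {perm I} :=
  perm (nonunit_map_inj (hf := asboolW (valP f))).

Lemma nonunit_permE f x : val (nonunit_perm f x) = val f (val x).
Proof. by rewrite permE. Qed.

Lemma nonunit_perm_inj : injective nonunit_perm.
Proof.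
move=> f g eq_fg; apply/val_inj/lfunP => v.
rewrite (calg_expand hB v) !linear_sum; apply: eq_bigr => t _.
rewrite !linearZ; congr (_ *: _).
case: (basisP t) => [|x] /=.
  by rewrite (calg_aut1 (asboolW (valP f))) (calg_aut1 (asboolW (valP g))).
by have := nonunit_permE f x; rewrite eq_fg nonunit_permE.
Qed.

(** The product of automorphisms composes from right to left and that of
permutations from left to right, so the morphism between the two groups
involves an inversion. *)
Definition nonunit_perm_inv (f : calg_aut star B) : {perm I} :=
  (nonunit_perm f)^-1%g.

Lemma nonunit_perm_invM : {morph nonunit_perm_inv : f g / (f * g)%g}.
Proof.
move=> f g; rewrite /nonunit_perm_inv -invMg; congr (_^-1)%g.
apply/permP => x; apply: val_inj.
by rewrite permM !nonunit_permE /= comp_lfunE.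
Qed.

HB.instance Definition _ :=
  isMultiplicative.Build (calg_aut star B) {perm I}
    nonunit_perm_inv nonunit_perm_invM.

Definition perms_realizable :=
  forall s : {perm I}, exists f : calg_aut star B, nonunit_perm f = s.

(** Given an abstract isomorphism, its inverse followed by the embedding of the
automorphisms into the permutations is an injection of a finite set into
itself, so the embedding is onto. *)
Lemma group_iso_realizable :
  group_iso (calg_aut star B) {perm I} <-> perms_realizable.
Proof.
split=> [[g [h gK hK]] s|real].
  have inj_e : injective (nonunit_perm \o h).
    exact: inj_comp nonunit_perm_inj (can_inj hK).
  have [k _ kK] := injF_bij inj_e.
  by exists (h (k s)); apply: kK.
have inv_real s : exists f, nonunit_perm_inv f = s.
  by have [f fs] := real s^-1%g; exists f; rewrite /nonunit_perm_inv fs invgK.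
have [h hK] := choice inv_real.
exists nonunit_perm_inv; exists h => // f.
by apply/nonunit_perm_inj/(can_inj invgK); apply: hK.
Qed.

Section OfPermutation.
Variable tau : B -> B.
Hypothesis tau_inj : injective tau.
Hypothesis tau1 : tau e = e.
Hypothesis tau_star : forall x, tau (starB x) = starB (tau x).
Hypothesis tau_strc : forall r s t,
  strc B (val (tau r)) (val (tau s)) (val (tau t)) =
  strc B (val r) (val s) (val t).

Definition perm_fun (v : A) : A :=
  \sum_(t : B) bcoord B v (val t) *: val (tau t).

Lemma perm_fun_is_linear : linear perm_fun.
Proof.
move=> a u v; rewrite /perm_fun scaler_sumr -big_split /=.
apply: eq_bigr => t _.
by rewrite bcoordZD scalerDl scalerA.
Qed.

HB.instance Definition _ :=
  GRing.isLinear.Build C A A *:%R perm_fun perm_fun_is_linear.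

Lemma perm_fun_basis t : perm_fun (val t) = val (tau t).
Proof.
rewrite /perm_fun (bigD1 t) //= (bcoord_val hB) eqxx scale1r.
rewrite big1 ?addr0 // => s st.
by rewrite (bcoord_val hB) eq_sym (negPf st) scale0r.
Qed.

Lemma bcoord_perm_fun v t :
  bcoord B (perm_fun v) (val (tau t)) = bcoord B v (val t).
Proof.
rewrite /perm_fun bcoord_sum (bigD1 t) //= bcoordZ (bcoord_val hB) eqxx mulr1.
rewrite big1 ?addr0 // => s st.
by rewrite bcoordZ (bcoord_val hB) (inj_eq tau_inj) (negPf st) mulr0.
Qed.

Lemma perm_fun_ext u v :
  (forall t, bcoord B u (val (tau t)) = bcoord B v (val (tau t))) -> u = v.
Proof.
move=> eq_uv; apply: (calg_ext hB) => t; have [k _ kK] := injF_bij tau_inj.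
by rewrite -(kK t).
Qed.

Lemma bcoord_mul u v t : bcoord B (u * v) t =
  \sum_(r : B) \sum_(s : B)
    bcoord B u (val r) * bcoord B v (val s) * strc B (val r) (val s) t.
Proof.
rewrite {1}(calg_expand hB u) {1}(calg_expand hB v) mulr_suml bcoord_sum.
apply: eq_bigr => r _; rewrite mulr_sumr bcoord_sum; apply: eq_bigr => s _.
by rewrite -scalerAl -scalerAr scalerA bcoordZ.
Qed.

(** Coordinates determine a vector, so products can be compared through their
coordinates at the elements tau t, where [bcoord_perm_fun] gives those of an
image. *)
Lemma perm_fun_aut : is_calg_aut star B (linfun perm_fun).
Proof.
have injf : injective (linfun perm_fun).
  move=> u v; rewrite !lfunE /= => eq_uv; apply: (calg_ext hB) => t.
  by rewrite -(bcoord_perm_fun u) -(bcoord_perm_fun v) eq_uv.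
split.
- exists (linfun perm_fun)^-1%VF; first exact/lker0_lfunK/lker0P.
  exact/lker0_lfunVK/lker0P.
- by rewrite lfunE /= -[1]/(val e) perm_fun_basis tau1.
- move=> u v; rewrite !lfunE /=; apply: perm_fun_ext => t.
  have tau_bij : bijective tau by apply: injF_bij.
  rewrite bcoord_perm_fun !bcoord_mul.
  rewrite [RHS](reindex tau) /=; last exact: onW_bij.
  apply: eq_bigr => r _; rewrite [RHS](reindex tau) /=; last exact: onW_bij.
  by apply: eq_bigr => s _; rewrite !bcoord_perm_fun tau_strc.
- move=> u; rewrite !lfunE /=.
  rewrite [in LHS](calg_expand hB u) (star_sum hB) linear_sum.
  rewrite /perm_fun (star_sum hB); apply: eq_bigr => t _.
  rewrite !(starZ hB) linearZ /= -[star (fsval t)]/(val (starB t)).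
  by rewrite perm_fun_basis tau_star.
apply/fsetP => u; apply/imfsetP/idP => /= [[r rB ->]|uB].
  by rewrite lfunE /= -[r]/(val [` rB]%fset) perm_fun_basis; apply: valP.
have [k _ kK] := injF_bij tau_inj.
exists (val (k [` uB]%fset)); first exact: valP.
by rewrite lfunE /= perm_fun_basis kK.
Qed.

End OfPermutation.

End Automorphisms.

(** * From all permutations to homogeneous and amorphic *)

Section SymmetricGroup.
Variables (C : numClosedFieldType) (A : falgType C) (star : A -> A).
Variables (B : {fset A}) (hB : is_calgebra star fullv B).
Local Notation I := (B `\ 1)%fset.
Local Notation e := (unitB hB).
Local Notation starB := (starB hB).
Local Notation nu := (@of_nonunit C A B).

Section Realizable.
Hypothesis real : perms_realizable star B.

Lemma realizable_homogeneous : homogeneous star B.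
Proof.
move=> r s rI sI; have [f fE] := real (tperm [` rI]%fset [` sI]%fset).
have <- : val f r = s.
  by rewrite -[r]/(val [` rI]%fset) -nonunit_permE fE tpermL.
rewrite (calg_aut_deg hB (asboolW (valP f))) //.
by have := rI; rewrite in_fsetD1 => /andP[].
Qed.

Section Blocks.
Variable pi : {set {set B}}.
Hypothesis pi_part : partition pi [set: B].
Hypothesis pi1 : [set r : B | val r == 1] \in pi.

(** A transposition inside a block moves no element to another block, and
elements of the fusion space have constant coordinates on blocks. *)
Lemma block_swap (P : {set B}) (x y : I) :
    P \in pi -> nu x \in P -> nu y \in P ->
  exists f : 'End(A), [/\ is_calg_aut star B f, f (val x) = val y &
    {in fusion_space pi, forall u, f u = u}].
Proof.
move=> Ppi xP yP; have [f fE] := real (tperm x y).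
have hf := asboolW (valP f).
exists (val f); split=> //; first by rewrite -nonunit_permE fE tpermL.
have f_swap t : exists2 t' : B, val f (val t) = val t' &
    t = t' \/ (t \in P /\ t' \in P).
  case: (basisP hB t) => [|z].
    by exists e; [exact: (calg_aut1 hf) | left].
  exists (nu (tperm x y z)).
    by rewrite -fE; exact: esym (nonunit_permE f z).
  by case: tpermP => [->|->|_ _]; [right|right|left].
move=> u uV; apply: (calg_ext hB) => t'.
have : val t' \in [fset val f r | r in B]%fset.
  by rewrite (calg_aut_basis hf); apply: valP.
case/imfsetP => r /= rB def_t'; rewrite def_t' (calg_aut_bcoord hB hf) //.
have [s fs Hs] := f_swap [` rB]%fset; rewrite fs.
case: Hs => [<- //|[rP sP]].
exact: (mem_fusion_space hB pi_part u).1 uV P Ppi _ _ rP sP.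
Qed.

(** The fusion space is the fixed space of the automorphisms that fix it
pointwise, because these include enough transpositions by [block_swap]. *)
Lemma fixed_mem_fusion_space v :
    (forall f, is_calg_aut star B f ->
       {in fusion_space pi, forall u, f u = u} -> f v = v) ->
  v \in fusion_space pi.
Proof.
move=> v_fix; apply/(mem_fusion_space hB pi_part) => P Ppi.
have Pe z : e \in P -> z \in P -> z = e.
  move=> eP zP; have := block_eq pi_part Ppi (unit_block hB pi1) eP (set11 e).
  by move=> defP; move: zP; rewrite defP inE => /eqP.
move=> x y; case: (basisP hB x) => [eP /(Pe _ eP) -> //|{}x].
case: (basisP hB y) => [xP eP|{}y xP yP]; first by rewrite (Pe _ eP xP).
have [f [hf fx fV]] := block_swap Ppi xP yP.
rewrite -[v in RHS](v_fix f) // -[RHS]/(bcoord B (f v) (val y)) -fx.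
by rewrite (calg_aut_bcoord hB hf) // (valP (nu x)).
Qed.
End Blocks.

Lemma realizable_amorphic : amorphic star B.
Proof.
move=> pi pi_part pi1; apply: (fusion_calgebra hB pi_part pi1).
  move=> u v uV vV; apply: (fixed_mem_fusion_space pi_part pi1) => f hf fV.
  by rewrite (calg_autM hf) !fV.
move=> u uV; apply: (fixed_mem_fusion_space pi_part pi1) => f hf fV.
by rewrite (calg_aut_star hf) fV.
Qed.
End Realizable.

(** * From homogeneous and amorphic to all permutations *)

Definition const_off (r s : B) (v : A) :=
  forall x y : B, x \notin [:: e; r; s] -> y \notin [:: e; r; s] ->
  bcoord B v (val x) = bcoord B v (val y).

(** The fibers of this function are the singletons of 1, r and s, and the set of
all other basis elements. *)
Definition isolate (r s x : B) : option B :=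
  if x \in [:: e; r; s] then Some x else None.

Lemma const_off_fusion r s v :
  v \in fusion_space (preim_partition (isolate r s) [set: B]) <->
  const_off r s v.
Proof.
split=> [/(mem_fusion_space hB (preim_partitionP _ _)) vc x y xo yo|vc].
  have [P Ppi xP] := block_exists (preim_partitionP (isolate r s) [set: B]) x.
  apply: (vc P Ppi x y xP).
  case/imsetP: Ppi xP => z _ ->; rewrite !inE => /eqP->.
  by rewrite /isolate (negPf xo) (negPf yo).
apply/(mem_fusion_space hB (preim_partitionP _ _)) => P Ppi x y.
case/imsetP: Ppi => z _ ->; rewrite !inE => /eqP -> /eqP; rewrite /isolate.
case: ifPn => xo; case: ifPn => yo //; first by case=> ->.
by move=> _; apply: vc.
Qed.

Lemma isolate_unit r s :
  [set x : B | val x == 1] \in preim_partition (isolate r s) [set: B].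
Proof.
apply/imsetP; exists e => //; apply/setP => x.
have iso_e : isolate r s e = Some e by rewrite /isolate inE eqxx.
rewrite !inE iso_e (_ : (val x == 1) = (x == e)); last by rewrite -val_eqE.
rewrite /isolate; case: ifPn => [_|]; first by rewrite eq_sym.
by rewrite inE negb_or => /andP[/negPf->].
Qed.

Section Amorphic.
Hypothesis amB : amorphic star B.

Lemma amorphic_star_algebra r s :
  is_star_algebra star (fusion_space (preim_partition (isolate r s) [set: B])).
Proof.
exact: calg_star_algebra (amB (preim_partitionP _ _) (isolate_unit r s)).
Qed.

Lemma const_offM r s u v :
  const_off r s u -> const_off r s v -> const_off r s (u * v).
Proof.
move=> /const_off_fusion uV /const_off_fusion vV; apply/const_off_fusion.
exact: star_algM (amorphic_star_algebra r s) _ _ uV vV.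
Qed.

Lemma const_off_star r s u : const_off r s u -> const_off r s (star u).
Proof.
move=> /const_off_fusion uV; apply/const_off_fusion.
exact: star_alg_star (amorphic_star_algebra r s) _ uV.
Qed.

Lemma const_off_basis (r s t : B) : t \in [:: e; r; s] -> const_off r s (val t).
Proof.
move=> tin x y xo yo; rewrite !(bcoord_val hB).
case: eqP xo => [<-|_]; first by rewrite tin.
by case: eqP yo => [<-|_]; rewrite ?tin.
Qed.

Hypothesis cardI : (2 < #|{: I}|)%N.

(** The fusion that isolates 1 and x contains the image of x under star. If that
were a third basis element y, a basis element z outside {1, x, y} would lie in
the same block as y and have a different coordinate. *)
Lemma amorphic_star_basis (r : B) : starB r = r.
Proof.
case: (basisP hB r) => [|x]; first by apply: val_inj; rewrite /= (star1 hB).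
move def_y: (starB (nu x)) => y; case: (basisP hB y) def_y => [xe|{}y yx].
  by rewrite -[RHS](starBK hB) xe; apply: val_inj; rewrite /= (star1 hB).
have [->//|xy] := eqVneq y x.
have [z zx zy] := third_point cardI x y.
have := const_off_star (const_off_basis (r := nu x) (s := nu x) (t := nu x) _).
rewrite !inE eqxx /= orbT => /(_ isT (nu y) (nu z)).
rewrite -[star _]/(val (starB (nu x))) yx !(bcoord_val hB) !inE.
rewrite !(inj_eq (@of_nonunit_inj _ _ _)) !(negPf (of_nonunit_neq1 hB _)).
rewrite (negPf xy) (negPf zx) eqxx [y == z]eq_sym (negPf zy).
by move=> /(_ isT isT)/eqP; rewrite oner_eq0.
Qed.

(** As star fixes the basis and the structure constants are real, star fixes
every product of two basis elements, whereas it reverses the factors. *)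
Lemma amorphic_commute (r s : B) : val r * val s = val s * val r :> A.
Proof.
have starv (t : B) : star (val t) = val t.
  by rewrite -[in RHS](amorphic_star_basis t).
have <- : star (val s * val r) = val r * val s by rewrite (starM hB) !starv.
rewrite [in LHS](calg_expand hB (val s * val r)) (star_sum hB).
rewrite [RHS](calg_expand hB); apply: eq_bigr => t _; rewrite (starZ hB) starv.
congr (_ *: _); apply: conj_Creal.
exact: (calg_real hB) (valP s) (valP r) (valP t).
Qed.

Lemma bcoord_mul_basis1 u (t : B) :
  bcoord B (u * val t) 1 = bcoord B u (val t) * deg star B (val t).
Proof.
rewrite {1}(calg_expand hB u) mulr_suml bcoord_sum (bigD1 t) //= big1 ?addr0.
  rewrite -scalerAl bcoordZ -/(strc B _ _ 1) (calg_strc1 hB (valP t) (valP t)).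
  by rewrite -[star (val t)]/(val (starB t)) amorphic_star_basis eqxx mulr1.
move=> s st; rewrite -scalerAl bcoordZ -/(strc B _ _ 1).
rewrite (calg_strc1 hB (valP s) (valP t)) -[star (val s)]/(val (starB s)).
by rewrite amorphic_star_basis val_eqE (negPf st) !mulr0.
Qed.

Hypothesis homB : homogeneous star B.

Local Notation c r s t := (strc B (val r) (val s) (val t)).

Lemma homogeneous_deg : exists2 k, 0 < k & forall x : I, deg star B (val x) = k.
Proof.
have [x0 _] := card_gt0P (ltn_trans (ltn0Sn 1) cardI).
exists (deg star B (val x0)); last by move=> x; apply: homB; apply: valP.
by apply: (calg_deg_gt0 hB); apply: (valP (nu x0)).
Qed.

Lemma nonunit_strcC (x y z : I) : c x y z = c y x z.
Proof.
by rewrite /strc -[val x]/(val (nu x)) -[val y]/(val (nu y)) amorphic_commute.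
Qed.

(** Up to the common degree, both sides are the coefficient of the unit in the
product of x, y and z. *)
Lemma nonunit_strcR (x y z : I) : c x y z = c y z x.
Proof.
have [k k0 degk] := homogeneous_deg.
apply: (mulIf (lt0r_neq0 k0)).
have E (u v w : I) : c u v w * k = bcoord B (val u * val v * val w) 1.
  by rewrite (bcoord_mul_basis1 _ (nu w)) degk.
rewrite !E; congr (bcoord B _ 1).
have com (u v : I) : val u * val v = val v * val u.
  exact: amorphic_commute (nu u) (nu v).
by rewrite (com x y) -mulrA (com x z) mulrA.
Qed.

Lemma nonunit_strc_const (x y z t : I) :
  z != x -> z != y -> t != x -> t != y -> c x y z = c x y t.
Proof.
move=> zx zy tx ty.
have xyb w : w \in [:: nu x; nu y] -> const_off (nu x) (nu y) (val w).
  by move=> w_in; apply: const_off_basis; rewrite inE w_in orbT.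
have off w : w != x -> w != y -> nu w \notin [:: e; nu x; nu y].
  move=> wx wy; rewrite !inE !(inj_eq (@of_nonunit_inj _ _ _)).
  rewrite (negPf wx) (negPf wy).
  by rewrite (negPf (of_nonunit_neq1 hB w)).
apply: (const_offM (xyb (nu x) _) (xyb (nu y) _) (x := nu z) (y := nu t)).
- by rewrite !inE eqxx.
- by rewrite !inE eqxx orbT.
- exact: off.
- exact: off.
Qed.

Lemma deg_functional_basis r :
  r \in B -> deg_functional star B r = deg star B r.
Proof.
move=> rB; have fB := calg_free hB.
rewrite /deg_functional (big_fsetD1 _ rB) /= (bcoord_basis fB) //.
rewrite eqxx mul1r big_seq_cond big1 ?addr0 // => s; rewrite andbT in_fsetD1.
by case/andP=> sr sB; rewrite (bcoord_basis fB) // eq_sym (negPf sr) mul0r.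
Qed.

(** Compare the degrees of both sides of the expansion of a product: the unit
contributes k when x = y, each other term contributes k times its
coefficient, and the degree of the product is k squared. *)
Lemma nonunit_strc_sum :
  exists k, forall x y : I, \sum_(z : I) c x y z = k - (x == y)%:R.
Proof.
have [k k0 degk] := homogeneous_deg; exists k => x y.
apply: (mulIf (lt0r_neq0 k0)).
have xB : val x \in B := valP (nu x).
have yB : val y \in B := valP (nu y).
have := calg_degM hB (memvf (val x)) (memvf (val y)).
rewrite (deg_functional_basis xB) (deg_functional_basis yB) !degk.
rewrite /deg_functional (big_fsetD1 _ (calg_one hB)) /=.
rewrite -(deg_functional_basis (calg_one hB)) (calg_deg1 hB) mulr1.
rewrite -/(strc B _ _ 1) (calg_strc1 hB xB yB) degk.
rewrite -[star (val x)]/(val (starB (nu x))) amorphic_star_basis.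
rewrite -[val (nu x)]/(val x) val_eqE big_seq_fsetE /= => sum_k.
rewrite mulrBl -sum_k [_%:R * k]mulrC [X in _ = X - _]addrC addrK mulr_suml.
by apply: eq_bigr => z _; rewrite -(degk z).
Qed.

Lemma nonunit_strc_perm (s : {perm I}) x y z : c (s x) (s y) (s z) = c x y z.
Proof.
have [k c_sum] := nonunit_strc_sum.
apply: (tensor_perm (c := fun x y z => c x y z) (k := k)) => //.
- exact: nonunit_strcC.
- exact: nonunit_strcR.
- exact: nonunit_strc_const.
Qed.

End Amorphic.

Section ExtendPerm.
Variable s : {perm I}.

Definition extend_perm (x : B) : B :=
  if insub (val x) is Some y then nu (s y) else x.

Lemma extend_perm_unit : extend_perm e = e.
Proof.
rewrite /extend_perm; case: insubP => // y.
by rewrite in_fsetD1 eqxx.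
Qed.

Lemma extend_perm_nonunit x : extend_perm (nu x) = nu (s x).
Proof. by rewrite /extend_perm -[val (nu x)]/(val x) valK. Qed.

Lemma extend_perm_inj : injective extend_perm.
Proof.
have ne x : (e == nu x) = false.
  by rewrite eq_sym (negPf (of_nonunit_neq1 hB x)).
move=> x y; case: (basisP hB x) => [|{}x]; case: (basisP hB y) => [|{}y].
- by [].
- by rewrite extend_perm_unit extend_perm_nonunit => /eqP; rewrite ne.
- by rewrite extend_perm_unit extend_perm_nonunit => /esym/eqP; rewrite ne.
by rewrite !extend_perm_nonunit => /of_nonunit_inj/perm_inj->.
Qed.

End ExtendPerm.

Lemma strc_mul1l (s t : B) : strc B 1 (val s) (val t) = (s == t)%:R.
Proof. by rewrite /strc mul1r (bcoord_val hB). Qed.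

Lemma strc_mul1r (s t : B) : strc B (val s) 1 (val t) = (s == t)%:R.
Proof. by rewrite /strc mulr1 (bcoord_val hB). Qed.

Theorem amorphic_realizable :
  #|` B| <> 3%N -> homogeneous star B -> amorphic star B ->
  perms_realizable star B.
Proof.
move=> cardB homB amB s.
have cardI : #|{: I}| <> 2%N.
  rewrite -cardfE => cI; apply: cardB.
  by rewrite (cardfsD1 1) (calg_one hB) cI.
have [cardI3|cardI1] := ltnP 2 #|{: I}|; last first.
  have {}cardI1 : (#|{: I}| <= 1)%N.
    by move: cardI cardI1; case: #|_| => [|[|[|n]]].
  exists 1%g; apply/permP => x; apply/val_inj; congr val.
  by apply: (fintype_le1P cardI1).
have starI := amorphic_star_basis amB cardI3.
have aut : is_calg_aut star B (linfun (perm_fun (extend_perm s))).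
  have inj_ext := inj_eq (@extend_perm_inj s).
  apply: (@perm_fun_aut _ _ _ _ hB (extend_perm s)).
  - exact: extend_perm_inj.
  - exact: extend_perm_unit.
  - by move=> x; rewrite !starI.
  have [k _ degk] := homogeneous_deg cardI3 homB.
  move=> x y z; case: (basisP hB x) => [|{}x].
    by rewrite extend_perm_unit !strc_mul1l inj_ext.
  case: (basisP hB y) => [|{}y].
    by rewrite extend_perm_unit !strc_mul1r inj_ext.
  case: (basisP hB z) => [|{}z].
    rewrite extend_perm_unit !(calg_strc1 hB (valP _) (valP _)).
    rewrite -![star (val _)]/(val (starB _)) !starI !val_eqE inj_ext.
    rewrite extend_perm_nonunit.
    by rewrite -[val (nu _)]/(val (s x)) -[val (nu x)]/(val x) !degk.
  rewrite !extend_perm_nonunit.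
  exact: (nonunit_strc_perm amB cardI3 homB).
exists (exist (fun f : 'End(A) => `[< is_calg_aut star B f >]) _ (asboolT aut)).
apply/permP => x; apply: val_inj.
rewrite nonunit_permE /= lfunE /= -[fsval x]/(val (nu x)) (perm_fun_basis hB).
by rewrite extend_perm_nonunit.
Qed.

End SymmetricGroup.

(* The rank 3 exception cannot be removed: every C-algebra with three basis
   elements is amorphic, and the one spanned in C x C x C by
     (1, 1, 1), (3, s, - s), (3, - 1 - s, - 1 + s), where s ^+ 2 = 2,
   is homogeneous of degree 3 but has no nontrivial automorphism. *)
Theorem theorem4p3 (R : realType) (A : falgType R[i]) (star : A -> A)
    (B : {fset A}) (hB : is_calgebra star fullv B) :
  (#|` B| <> 3%N -> homogeneous star B /\ amorphic star B ->
     group_iso (calg_aut star B) {perm (B `\ 1)%fset}) /\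
  (group_iso (calg_aut star B) {perm (B `\ 1)%fset} ->
     homogeneous star B /\ amorphic star B).
Proof.
split=> [cardB [homB amB]|iso].
  by apply/(group_iso_realizable hB)/(amorphic_realizable hB).
have real := (group_iso_realizable hB).1 iso.
split; first exact: realizable_homogeneous hB real.
exact: realizable_amorphic hB real.
Qed.
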